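(* Let $k$ be an algebraically closed field of characteristic $0$. Every pseudo-compact dg algebra over $k$ is (algebraically and topologically) a direct product of Hinich algebras and acyclic algebras. Moreover, if $(A_i)_{i\in I}$ and $(B_j)_{j\in J}$ are families of algebras each of which is a Hinich algebra or an acyclic algebra, then a morphism of pseudo-compact dg algebras $f\colon\prod_{i\in I}A_i\to\prod_{j\in J}B_j$ corresponds precisely to a choice, for each $j\in J$, of an index $i_j\in I$ and a continuous dg algebra homomorphism $f_j\colon A_{i_j}\to B_j$ (the composition of $f$ with the projection onto $B_j$ being the projection $\prod_{i\in I}A_i\to A_{i_j}$ followed by $f_j$).
   Context: $k$ is an algebraically closed field of characteristic $0$; dg means $\mathbb Z$-graded with a differential of degree $-1$; algebras are unital and graded commutative. A pseudo-compact dg algebra is the inverse limit of a diagram of unital finite-dimensional dg algebras, with the inverse limit topology (finite-dimensional algebras being discrete); morphisms are unit-preserving continuous dg algebra maps. A local pseudo-compact dg algebra is one having a unique maximal graded ideal, possibly not closed under the differential. A Hinich algebra is a local pseudo-compact dg algebra whose maximal ideal is closed under the differential. An acyclic algebra is a local pseudo-compact dg algebra in which every closed element is a boundary. Direct products carry the product topology. *)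

(* Defs.v *)
From HB Require Import structures.
From mathcomp Require Import all_boot all_order all_algebra.
From mathcomp Require Import all_classical topology.

Set Implicit Arguments.
Unset Strict Implicit.
Unset Printing Implicit Defensive.

Import GRing.Theory.

Local Open Scope classical_set_scope.
Local Open Scope ring_scope.

(* preTopologicalLmodType (tvs.v) requires a numDomainType of scalars. No
   compatibility between the topology and the operations is imposed here. *)
#[short(type="topSpaceLmodType")]
HB.structure Definition TopSpaceLmodule (K : pzRingType) :=
  {M of Topological M & GRing.Lmodule K M}.

Section ProdLmodule.
Context (K : pzRingType) (I : Type) (T : I -> topSpaceLmodType K).
Local Notation P := (prod_topology T).
Implicit Types x y z : P.

Let zero : P := fun=> 0.
Let opp x : P := fun i => - x i.
Let add x y : P := fun i => x i + y i.
Let scale (a : K) x : P := fun i => a *: x i.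

Let addA : associative add.
Proof. by move=> x y z; apply: functional_extensionality_dep => i; exact: addrA. Qed.
Let addC : commutative add.
Proof. by move=> x y; apply: functional_extensionality_dep => i; exact: addrC. Qed.
Let add0 : left_id zero add.
Proof. by move=> x; apply: functional_extensionality_dep => i; exact: add0r. Qed.
Let addN : left_inverse zero opp add.
Proof. by move=> x; apply: functional_extensionality_dep => i; exact: addNr. Qed.

HB.instance Definition _ := GRing.isZmodule.Build P addA addC add0 addN.

Let scalerA_ a b x : scale a (scale b x) = scale (a * b) x.
Proof. by apply: functional_extensionality_dep => i; exact: scalerA. Qed.
Let scale1_ : left_id 1 scale.
Proof. by move=> x; apply: functional_extensionality_dep => i; exact: scale1r. Qed.
Let scaleDr_ : right_distributive scale +%R.
Proof. by move=> a x y; apply: functional_extensionality_dep => i; exact: scalerDr. Qed.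
Let scaleDl_ x : {morph scale^~ x : a b / a + b}.
Proof. by move=> a b; apply: functional_extensionality_dep => i; exact: scalerDl. Qed.

HB.instance Definition _ :=
  GRing.Zmodule_isLmodule.Build K P scalerA_ scale1_ scaleDr_ scaleDl_.

End ProdLmodule.

(* A unital graded commutative dg algebra with a topology on each homogeneous
   component. Products and differentials take the degree equation as an
   argument, so that no transport along equalities of degrees occurs in the
   laws. Continuity of the operations is not imposed: for pseudo-compact
   algebras (see below) it is automatic. *)
Record tdga (k : fieldType) := Tdga {
  gcomp :> int -> topSpaceLmodType k;
  gmul : forall m n p : int, m + n = p -> gcomp m -> gcomp n -> gcomp p;
  gone : gcomp 0;
  gdiff : forall m n : int, m = n + 1 -> gcomp m -> gcomp n;
  gmul_linearl : forall m n p (e : m + n = p) (y : gcomp n),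
    linear (fun x : gcomp m => gmul e x y);
  gmul_linearr : forall m n p (e : m + n = p) (x : gcomp m),
    linear (fun y : gcomp n => gmul e x y);
  gmulA : forall l m n p q r (elm : l + m = p) (epn : p + n = r)
    (emn : m + n = q) (elq : l + q = r) (x : gcomp l) (y : gcomp m) (z : gcomp n),
    gmul epn (gmul elm x y) z = gmul elq x (gmul emn y z);
  gmul1 : forall n (e : 0 + n = n) (x : gcomp n), gmul e gone x = x;
  gmulC : forall m n p (e : m + n = p) (e' : n + m = p)
    (x : gcomp m) (y : gcomp n),
    gmul e x y = (-1 : k) ^ (m * n) *: gmul e' y x;
  gdiff_linear : forall m n (e : m = n + 1), linear (gdiff e);
  gdiff_diff : forall l m n (e : l = m + 1) (e' : m = n + 1) (x : gcomp l),
    gdiff e' (gdiff e x) = 0;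
  gdiff_mul : forall m n p m' n' p' (e : m + n = p) (em : m = m' + 1)
    (en : n = n' + 1) (ep : p = p' + 1) (el : m' + n = p') (er : m + n' = p')
    (x : gcomp m) (y : gcomp n),
    gdiff ep (gmul e x y) =
      gmul el (gdiff em x) y + (-1 : k) ^ m *: gmul er x (gdiff en y)
}.
Arguments gmul {k} A {m n p} e x y : rename.
Arguments gone {k} A : rename.
Arguments gdiff {k} A {m n} e x : rename.

Record tdga_mor (k : fieldType) (A B : tdga k) := TdgaMor {
  mor_fun :> forall n : int, A n -> B n;
  mor_linear : forall n, linear (@mor_fun n);
  mor_mul : forall m n p (e : m + n = p) (x : A m) (y : A n),
    mor_fun (gmul A e x y) = gmul B e (mor_fun x) (mor_fun y);
  mor_one : mor_fun (gone A) = gone B;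
  mor_diff : forall m n (e : m = n + 1) (x : A m),
    mor_fun (gdiff A e x) = gdiff B e (mor_fun x);
  mor_continuous : forall n, continuous (@mor_fun n)
}.
Arguments mor_fun {k A B} f n x : rename.

Definition isomorphic (k : fieldType) (A B : tdga k) : Prop :=
  exists (f : tdga_mor A B) (g : tdga_mor B A),
    (forall n, cancel (f n) (g n)) /\ (forall n, cancel (g n) (f n)).

Section ProdTdga.
Context (k : fieldType) (I : Type) (A : I -> tdga k).

Let pcomp (n : int) : topSpaceLmodType k := prod_topology (fun i => A i n).
Let pmul (m n p : int) (e : m + n = p) (x : pcomp m) (y : pcomp n) : pcomp p :=
  fun i => gmul (A i) e (x i) (y i).
Let pone : pcomp 0 := fun i => gone (A i).
Let pdiff (m n : int) (e : m = n + 1) (x : pcomp m) : pcomp n :=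
  fun i => gdiff (A i) e (x i).

Definition prod_tdga : tdga k.
Proof.
apply: (@Tdga k pcomp pmul pone pdiff).
- by move=> m n p e y a x x'; apply: functional_extensionality_dep => i;
    exact: gmul_linearl.
- by move=> m n p e x a y y'; apply: functional_extensionality_dep => i;
    exact: gmul_linearr.
- by move=> *; apply: functional_extensionality_dep => i; exact: gmulA.
- by move=> *; apply: functional_extensionality_dep => i; exact: gmul1.
- by move=> *; apply: functional_extensionality_dep => i; exact: gmulC.
- by move=> m n e a x x'; apply: functional_extensionality_dep => i;
    exact: gdiff_linear.
- by move=> *; apply: functional_extensionality_dep => i; exact: gdiff_diff.
- by move=> *; apply: functional_extensionality_dep => i; exact: gdiff_mul.
Defined.
End ProdTdga.

Definition finite_dim (K : fieldType) (V : lmodType K) : Prop :=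
  exists (r : nat) (b : 'I_r -> V),
    forall x, exists c : 'I_r -> K, x = \sum_i c i *: b i.

(* Finite-dimensional in total, and discrete. *)
Definition finite_dim_discrete (k : fieldType) (A : tdga k) : Prop :=
  [/\ forall n, finite_dim (A n),
      exists N : nat, forall n : int, (N < `|n|)%N -> forall x : A n, x = 0
    & forall n (U : set (A n)), open U].

Record category := Category {
  ob :> Type;
  hom : ob -> ob -> Type;
  idc : forall a, hom a a;
  compc : forall a b c, hom b c -> hom a b -> hom a c;
  compc1 : forall a b (u : hom a b), compc u (idc a) = u;
  comp1c : forall a b (u : hom a b), compc (idc b) u = u;
  compcA : forall a b c d (u : hom c d) (v : hom b c) (w : hom a b),
    compc u (compc v w) = compc (compc u v) w
}.
Arguments hom {c} a b : rename.
Arguments idc {c} a : rename.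

Record diagram (k : fieldType) (C : category) := Diagram {
  dob :> C -> tdga k;
  dmor : forall a b : C, hom a b -> tdga_mor (dob a) (dob b);
  dmor1 : forall (a : C) n (x : dob a n), dmor (idc a) n x = x;
  dmor_comp : forall (a b c : C) (u : hom b c) (v : hom a b) n (x : dob a n),
    dmor (compc u v) n x = dmor u n (dmor v n x)
}.
Arguments dmor {k C} D {a b} u : rename.

(* A, with projections pi, is the limit of D: in each degree, A n is the set of
   compatible families, with the topology induced by the product topology. *)
Definition is_limit (k : fieldType) (C : category) (D : diagram k C)
    (A : tdga k) (pi : forall c, tdga_mor A (D c)) : Prop :=
  [/\ forall (a b : C) (u : hom a b) n (x : A n),
        dmor D u n (pi a n x) = pi b n x,
      forall n (y : forall c, D c n),
        (forall (a b : C) (u : hom a b), dmor D u n (y a) = y b) ->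
        exists! x : A n, forall c, pi c n x = y c
    & forall n (U : set (A n)), open U <->
        open (U : set (initial_topology
          (fun x : A n => (fun c => pi c n x) : prod_topology (fun c => D c n))))].

Definition pseudo_compact (k : fieldType) (A : tdga k) : Prop :=
  exists (C : category) (D : diagram k C) (pi : forall c, tdga_mor A (D c)),
    (forall c, finite_dim_discrete (D c)) /\ is_limit pi.

(* Graded commutativity makes left ideals two-sided; closure under scalars and
   opposites follows from multiplication by multiples of the unit. *)
Definition graded_ideal (k : fieldType) (A : tdga k)
    (S : forall n, set (A n)) : Prop :=
  [/\ forall n, S n 0,
      forall n (x y : A n), S n x -> S n y -> S n (x + y)
    & forall m n p (e : m + n = p) (a : A m) (x : A n),
        S n x -> S p (gmul A e a x)].

Definition proper_ideal (k : fieldType) (A : tdga k)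
    (S : forall n, set (A n)) : Prop :=
  graded_ideal S /\ ~ (forall n (x : A n), S n x).

Definition maximal_ideal (k : fieldType) (A : tdga k)
    (S : forall n, set (A n)) : Prop :=
  proper_ideal S /\
  forall S' : (forall n, set (A n)), proper_ideal S' ->
    (forall n, S n `<=` S' n) -> forall n, S' n `<=` S n.

Definition local_pc (k : fieldType) (A : tdga k) : Prop :=
  pseudo_compact A /\ exists! S : (forall n, set (A n)), maximal_ideal S.

Definition hinich (k : fieldType) (A : tdga k) : Prop :=
  local_pc A /\
  forall S : (forall n, set (A n)), maximal_ideal S ->
    forall m n (e : m = n + 1) (x : A m), S m x -> S n (gdiff A e x).

Definition acyclic (k : fieldType) (A : tdga k) : Prop :=
  local_pc A /\
  forall m n l (e : m = n + 1) (e' : l = m + 1) (x : A m),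
    gdiff A e x = 0 -> exists y : A l, gdiff A e' y = x.

(* Main.v *)
From HB Require Import structures.
From mathcomp Require Import all_boot all_order all_algebra.
From mathcomp Require Import all_classical topology ring.
Require Import Defs.

(** Everything happens in degree zero. An idempotent [e] of degree zero is a
    cycle (the Leibniz rule forces [d e = 0]), so that [e A] is again a dg
    algebra, and a decomposition of [1] into orthogonal idempotents of degree
    zero is a decomposition of the dg algebra.

    Existence. Let [A] be the limit of finite-dimensional algebras [D c], with
    projections [pi c]. In a finite-dimensional algebra every nonempty set of
    idempotents has a minimal element, because among the terms of any sequence
    of vectors one is a combination of later ones ([finite_dim_dependent]).
    Computing minima in each [D c] shows that a nonempty multiplicatively closed
    set of idempotents of [A] has an infimum ([limit_idem_inf]). Hence any nonzero idempotent of
    some [D c] meets the image of a primitive idempotent of [A]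
    ([primitive_meets]), and in each [D c] finitely many primitive idempotents
    of [A] suffice to cover [1] ([primitive_cover]). This is what makes
    [A -> prod_e e A], over all primitive [e], bijective and a homeomorphism
    ([factors_isomorphic]).

    Each factor is local: it is pseudo-compact, being the limit of the algebras
    [pi c e (D c)] ([limit_corner]), and it has no idempotents of degree zero
    besides 0 and 1. In a finite-dimensional commutative algebra each [x] has a
    unique generalized inverse [z], for which [x z] is the idempotent that
    separates the part where [x] is invertible from the part where it is
    nilpotent (Fitting). Uniqueness makes [z] compatible with the diagram, so it
    exists in [A]; if [x z] can only be 0 or 1, then [x] is invertible or
    topologically nilpotent, and one of [x], [1 - x] is invertible
    ([limit_unit_or]). The homogeneous non-units then form the unique maximal
    graded ideal. If [d] preserves it the factor is a Hinich algebra; otherwise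
    some [d x] is a unit, which makes [1] a boundary and the factor acyclic
    ([hinich_or_acyclic]).

    Morphisms. In a local algebra the only idempotents of degree zero are 0 and
    1, as [e] and [1 - e] would otherwise lie in maximal ideals, which cannot
    coincide ([unique_maximal_idem]). A morphism from a product to a local
    algebra thus sends each of the orthogonal idempotents of the factors to 0 or
    1; at most one goes to 1, and by continuity not all go to 0, since finite
    sums of them accumulate at 1 ([mor_hits_idem]). The morphism factors through
    the projection to the distinguished factor. *)

Set Implicit Arguments.
Unset Strict Implicit.
Unset Printing Implicit Defensive.

Import GRing.Theory.

Local Open Scope classical_set_scope.
Local Open Scope ring_scope.

(** * Graded multiplication and differential *)

Section GradedMultiplication.
Context (k : fieldType) (A : tdga k).

Lemma gmul_irr m n p (e e' : m + n = p) (x : A m) (y : A n) :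
  gmul A e x y = gmul A e' x y.
Proof. by rewrite (Prop_irrelevance e e'). Qed.

Lemma gmulDl m n p (e : m + n = p) (x x' : A m) (y : A n) :
  gmul A e (x + x') y = gmul A e x y + gmul A e x' y.
Proof. by have := gmul_linearl e y 1 x x'; rewrite !scale1r. Qed.

Lemma gmulDr m n p (e : m + n = p) (x : A m) (y y' : A n) :
  gmul A e x (y + y') = gmul A e x y + gmul A e x y'.
Proof. by have := gmul_linearr e x 1 y y'; rewrite !scale1r. Qed.

Lemma gmul0l m n p (e : m + n = p) (y : A n) : gmul A e (0 : A m) y = 0.
Proof. by apply: (addrI (gmul A e 0 y)); rewrite -gmulDl !addr0. Qed.

Lemma gmul0r m n p (e : m + n = p) (x : A m) : gmul A e x (0 : A n) = 0.
Proof. by apply: (addrI (gmul A e x 0)); rewrite -gmulDr !addr0. Qed.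

Lemma gmulZl m n p (e : m + n = p) c (x : A m) (y : A n) :
  gmul A e (c *: x) y = c *: gmul A e x y.
Proof. by have := gmul_linearl e y c x 0; rewrite !addr0 gmul0l addr0. Qed.

Lemma gmulZr m n p (e : m + n = p) c (x : A m) (y : A n) :
  gmul A e x (c *: y) = c *: gmul A e x y.
Proof. by have := gmul_linearr e x c y 0; rewrite !addr0 gmul0r addr0. Qed.

Lemma gdiffD m n (e : m = n + 1) (x y : A m) :
  gdiff A e (x + y) = gdiff A e x + gdiff A e y.
Proof. by have := gdiff_linear e 1 x y; rewrite !scale1r. Qed.

Lemma gdiff0 m n (e : m = n + 1) : gdiff A e (0 : A m) = 0.
Proof. by apply: (addrI (gdiff A e 0)); rewrite -gdiffD !addr0. Qed.

End GradedMultiplication.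

(** * The commutative ring of elements of degree zero *)

(** An alias of the component of degree zero, to which the structure of a
    commutative ring is attached; it may be the zero ring. *)
Definition deg0 (k : fieldType) (A : tdga k) : Type := A 0.

HB.instance Definition _ (k : fieldType) (A : tdga k) :=
  GRing.Lmodule.copy (deg0 A) (A 0).

Section Degree0Ring.
Context (k : fieldType) (A : tdga k).

Definition mul0 (x y : deg0 A) : deg0 A := gmul A (addr0 0) x y.

Let mul0A : associative mul0.
Proof. by move=> x y z; rewrite /mul0 -(gmulA (addr0 0) (addr0 0)). Qed.
Let mul0C : commutative mul0.
Proof.
by move=> x y; rewrite /mul0 (gmulC (addr0 0) (addr0 0)) mul0r expr0z scale1r.
Qed.
Let mul01 : left_id (gone A : deg0 A) mul0.
Proof. by move=> x; rewrite /mul0 gmul1. Qed.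
Let mul0D : left_distributive mul0 +%R.
Proof. by move=> x y z; rewrite /mul0 gmulDl. Qed.

HB.instance Definition _ :=
  GRing.Zmodule_isComPzRing.Build (deg0 A) mul0A mul0C mul01 mul0D.

Lemma gmul0E (e : 0 + 0 = 0 :> int) (x y : deg0 A) : gmul A e x y = x * y.
Proof. exact: gmul_irr. Qed.

Lemma gone0E : gone A = 1 :> deg0 A. Proof. by []. Qed.

Lemma scale0Al c (x y : deg0 A) : c *: (x * y) = (c *: x) * y.
Proof. by rewrite -!(gmul0E (addr0 0)) gmulZl. Qed.

Lemma scale0Ar c (x y : deg0 A) : c *: (x * y) = x * (c *: y).
Proof. by rewrite -!(gmul0E (addr0 0)) gmulZr. Qed.

Definition act n (a : deg0 A) (x : A n) : A n := gmul A (add0r n) a x.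

Lemma gmul_act n (e : 0 + n = n) (a : deg0 A) (x : A n) : gmul A e a x = act a x.
Proof. exact: gmul_irr. Qed.

Lemma act1 n (x : A n) : act 1 x = x. Proof. exact: gmul1. Qed.
Lemma actM n a b (x : A n) : act (a * b) x = act a (act b x).
Proof. exact: (gmulA (addr0 0) (add0r n) (add0r n) (add0r n)). Qed.
Lemma actDl n a b (x : A n) : act (a + b) x = act a x + act b x.
Proof. exact: gmulDl. Qed.
Lemma actDr n a (x y : A n) : act a (x + y) = act a x + act a y.
Proof. exact: gmulDr. Qed.
Lemma act0l n (x : A n) : act 0 x = 0. Proof. exact: gmul0l. Qed.
Lemma actBl n a b (x : A n) : act (a - b) x = act a x - act b x.
Proof. by apply/eqP; rewrite eq_sym subr_eq -actDl subrK. Qed.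
Lemma actBr n a (x y : A n) : act a (x - y) = act a x - act a y.
Proof. by apply/eqP; rewrite eq_sym subr_eq -actDr subrK. Qed.
Lemma act0r n a : act a (0 : A n) = 0. Proof. exact: gmul0r. Qed.
Lemma actZr n a c (x : A n) : act a (c *: x) = c *: act a x.
Proof. exact: gmulZr. Qed.
Lemma act_sumr n a (I : Type) (r : seq I) (F : I -> A n) :
  act a (\sum_(i <- r) F i) = \sum_(i <- r) act a (F i).
Proof. exact: (big_morph _ (actDr a) (act0r n a)). Qed.

Lemma act_mull m n p (e : m + n = p) a (x : A m) (y : A n) :
  gmul A e (act a x) y = act a (gmul A e x y).
Proof. exact: gmulA. Qed.

Lemma act_mulr m n p (e : m + n = p) a (x : A m) (y : A n) :
  gmul A e x (act a y) = act a (gmul A e x y).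
Proof.
have e' : n + m = p by rewrite addrC.
by rewrite (gmulC e e') act_mull (gmulC e e') actZr.
Qed.

Lemma act0E a (x : deg0 A) : act a (x : A 0) = a * x. Proof. exact: gmul_irr. Qed.

(** Leibniz gives [d e = 2 (e * d e)] for an idempotent [e]; multiplying by [e]
    and comparing, [e * d e = 0] and hence [d e = 0]. *)
Lemma gdiff_idem m (em : 0 = m + 1 :> int) (a : deg0 A) :
  a * a = a -> gdiff A em (a : A 0) = 0.
Proof.
move=> aa; set b := gdiff A em a.
have bE : b = act a b + act a b.
  have em0 : m + 0 = m by rewrite addr0.
  rewrite {1}/b -{1}aa -(gmul0E (addr0 0)) (gdiff_mul _ em em em em0 (add0r m)).
  rewrite expr0z scale1r gmul_act -/b; congr (_ + _).
  by rewrite (gmulC em0 (add0r m)) mulr0 expr0z scale1r gmul_act.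
have : act a b = 0.
  by apply: (addrI (act a b)); rewrite addr0 {3}bE actDr -!actM aa.
by move=> ab; rewrite bE ab addr0.
Qed.

Lemma gdiff_act m n (e : m = n + 1) (a : deg0 A) (x : A m) : a * a = a ->
  gdiff A e (act a x) = act a (gdiff A e x).
Proof.
move=> aa.
have em : 0 = (-1) + 1 :> int by rewrite addNr.
have en : -1 + m = n by rewrite e addrC addrK.
rewrite /act (gdiff_mul (add0r m) em e e en (add0r n)) gdiff_idem // gmul0l add0r.
by rewrite expr0z scale1r.
Qed.

End Degree0Ring.
Arguments act {k A n} a x.

(** * Morphisms *)

Section Mor.
Context (k : fieldType) (A B : tdga k) (f : tdga_mor A B).

Lemma morD n (x y : A n) : f n (x + y) = f n x + f n y.
Proof. by have := @mor_linear _ _ _ f n 1 x y; rewrite !scale1r. Qed.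
Lemma mor0 n : f n 0 = 0.
Proof. by apply: (addrI (f n 0)); rewrite -morD !addr0. Qed.
Lemma morZ n c (x : A n) : f n (c *: x) = c *: f n x.
Proof. by have := @mor_linear _ _ _ f n c x 0; rewrite !addr0 mor0 addr0. Qed.
Lemma morN n (x : A n) : f n (- x) = - f n x.
Proof. by rewrite -scaleN1r morZ scaleN1r. Qed.
Lemma morB n (x y : A n) : f n (x - y) = f n x - f n y.
Proof. by rewrite morD morN. Qed.

Definition mor_deg0 (x : deg0 A) : deg0 B := f 0 x.

Let mor_deg0B : zmod_morphism mor_deg0.
Proof. by move=> x y; exact: morB. Qed.
HB.instance Definition _ := GRing.isZmodMorphism.Build _ _ mor_deg0 mor_deg0B.
Let mor_deg0M : monoid_morphism mor_deg0.
Proof. by split; [exact: mor_one | move=> x y; exact: mor_mul]. Qed.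
HB.instance Definition _ := GRing.isMonoidMorphism.Build _ _ mor_deg0 mor_deg0M.

Lemma mor_act n a (x : A n) : f n (act a x) = act (mor_deg0 a) (f n x).
Proof. exact: mor_mul. Qed.
End Mor.
Arguments mor_deg0 {k A B} f x : simpl never.

(** * Product topologies and dependent choice *)

Lemma dep_choice (I : Type) (T : I -> Type) (P : forall i, T i -> Prop) :
  (forall i, exists y, P i y) -> exists f : (forall i, T i), forall i, P i (f i).
Proof.
by move=> exP; exists (fun i => projT1 (cid (exP i))) => i; exact: projT2 (cid (exP i)).
Qed.

Section ProductTopology.
Context (I : Type) (K : I -> topologicalType).
Local Notation P := (prod_topology K).

Lemma prod_eval_continuous i : continuous (fun x : P => x i).
Proof.
move=> x U nU.
have /cvg_sup/(_ i) xi : nbhs x --> x by [].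
by apply: xi; exact: initial_continuous.
Qed.

Lemma prod_continuous (T : topologicalType) (h : T -> P) :
  (forall i, continuous (fun t => h t i)) -> continuous h.
Proof.
move=> hi t; apply/cvg_sup => i.
have : continuous (h : T -> initial_topology (fun x : P => x i)).
  by apply/continuousP => _ [V oV <-]; have /continuousP := hi i; apply.
by move=> /(_ t).
Qed.

(** The sets that contain every family agreeing with [x] at some finite set of
    indices form a filter that converges to [x] in each coordinate. *)
Lemma prod_nbhs_finite (x : P) (U : set P) : nbhs x U ->
  exists s : seq {classic I},
    forall y : P, (forall i : I, (i : {classic I}) \in s -> y i = x i) -> U y.
Proof.
pose F : set_system P := [set V | exists s : seq {classic I},
    forall y : P, (forall i : I, (i : {classic I}) \in s -> y i = x i) -> V y].
have FF : Filter F.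
  split; first by exists [::].
    move=> V W [s sV] [t tW]; exists (s ++ t) => y yx; split.
      by apply: sV => i si; apply: yx; rewrite mem_cat si.
    by apply: tW => i ti; apply: yx; rewrite mem_cat ti orbT.
  by move=> V W VW [s sV]; exists s => y /sV /VW.
suff : F --> x by exact.
apply/cvg_sup => i V; rewrite nbhsE => -[_ [[W oW <-] Wx] WV].
exists [:: i : {classic I}] => y yx; apply: WV; rewrite /= yx ?inE //.
Qed.

End ProductTopology.

Lemma discrete_continuous (T U : topologicalType) (h : T -> U) :
  (forall V : set T, open V) -> continuous h.
Proof.
move=> disc t V Vt; apply: open_nbhs_nbhs; split; first exact: disc.
exact: nbhs_singleton Vt.
Qed.

Lemma near_seq (T : eqType) (U : Type) (F : set_system U) (s : seq T)
    (Q : T -> set U) : Filter F ->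
  (forall e, e \in s -> F (Q e)) -> F [set u | forall e, e \in s -> Q e u].
Proof.
move=> FF; elim: s => [|e s IH] sF; first by apply: filterS filterT.
apply: filterS2 (sF e (mem_head _ _)) (IH _) => [u Qe Qs f|f fs].
  by rewrite inE => /orP[/eqP ->//|]; exact: Qs.
by apply: sF; rewrite inE fs orbT.
Qed.

(** * Idempotents and generalized inverses in finite dimension *)

(** The form of linear dependence from which the chain arguments below follow:
    applied to a decreasing sequence of idempotents it shows that the sequence
    cannot decrease strictly, and applied to the powers of [x] it gives
    [x ^+ m = x ^+ m.+1 * y]. *)
Lemma finite_dim_dependent (k : fieldType) (V : lmodType k) (v : nat -> V) :
  finite_dim V ->
  exists (N : nat) (m : 'I_N) (a : 'I_N -> k),
    v m = \sum_(i < N | (m < i)%N) a i *: v i.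
Proof.
move=> [r [b spanb]].
have [c cE] := choice (fun i => spanb (v i)).
pose M : 'M[k]_(r.+1, r) := \matrix_(i, j) c i j.
(* More rows than columns. *)
have kerM : kermx M != 0.
  by rewrite -mxrank_eq0 mxrank_ker subn_eq0 -ltnNge ltnS rank_leq_col.
have /rowV0Pn[u /sub_kermxP uM u0] := kerM.
have vdep : \sum_(i < r.+1) u 0 i *: v i = 0.
  under eq_bigr => i _ do rewrite cE scaler_sumr.
  rewrite exchange_big big1 //= => j _.
  under eq_bigr => i _ do rewrite scalerA.
  have uMj : \sum_(i < r.+1) u 0 i * c i j = (u *m M) 0 j.
    by rewrite mxE; apply: eq_bigr => i _; rewrite mxE.
  by rewrite -scaler_suml uMj uM mxE scale0r.
have [i0 ui0] : exists i, u 0 i != 0.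
  by apply/existsP; rewrite -negb_forall; apply: contraNN u0 => /forallP u0;
    apply/eqP/rowP => i; rewrite mxE; apply/eqP.
(* The least index with a nonzero coefficient is the one to solve for. *)
case: (@arg_minnP _ i0 (fun i => u 0 i != 0) 
  (fun i : 'I_r.+1 => i : nat) ui0) => m um mmin.
exists r.+1, m, (fun i => - ((u 0 m)^-1 * u 0 i)).
apply: (scalerI um); rewrite scaler_sumr.
under eq_bigr => i _ do rewrite scalerA mulrN mulVKf // scaleNr.
rewrite sumrN; apply/eqP; rewrite -addr_eq0; apply/eqP.
rewrite -[RHS]vdep [RHS](bigD1 m) //= [in RHS](bigID (fun i : 'I_r.+1 => (m < i)%N)) /=.
rewrite [X in _ = _ + (_ + X)]big1 ?addr0 => [|i /andP[im]]; last first.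
  rewrite -leqNgt => lim; suff -> : u 0 i = 0 by rewrite scale0r.
  apply/eqP; apply: contraNT im => /mmin mi; apply/eqP/val_inj => /=.
  by apply/eqP; rewrite eqn_leq lim.
congr (_ + _); apply: eq_bigl => i.
by case: eqVneq => // ->; rewrite ltnn.
Qed.

Section FiniteDimensional.
Context (k : fieldType) (D : tdga k).
Hypothesis fdD : finite_dim (D 0).

(** Otherwise there is a strictly decreasing sequence [w] in [S]; some [w m] is
    a combination of later terms, all of which absorb [w m.+1], so that
    [w m * w m.+1 = w m], that is [w m = w m.+1]. *)
Lemma idem_minimal (S : set (deg0 D)) : S !=set0 ->
  (forall e, S e -> e * e = e) ->
  exists2 e, S e & forall f, S f -> f * e = f -> f = e.
Proof.
move=> [e0 Se0] idS; apply: contrapT => nomin.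
have next (e : {e | S e}) : exists f : {e | S e},
    sval f * sval e = sval f /\ sval f <> sval e.
  case: e => e Se; apply: contrapT => nof; apply: nomin; exists e => // f Sf fe.
  by apply: contrapT => fne; apply: nof; exists (exist _ f Sf).
have [g gP] := choice next.
pose v i := iter i g (exist _ e0 Se0).
pose w i : deg0 D := sval (v i).
have wS i : w i.+1 * w i = w i.+1 by exact: (gP (v i)).1.
have wSlt m i : (m < i)%N -> w i * w m.+1 = w i.
  elim: i => // i IH; rewrite ltnS leq_eqVlt => /orP[/eqP ->|/IH wi].
    by apply: idS; exact: (svalP (v i.+1)).
  by rewrite -wS -mulrA wi.
have [N [m [a wm]]] := finite_dim_dependent w fdD.
apply: (gP (v m)).2; change (w m.+1 = w m).
rewrite -[LHS]wS mulrC wm; apply: esym.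
rewrite mulr_suml; apply: eq_bigr => i mi.
by rewrite -scale0Al wSlt.
Qed.

(** The Drazin inverse: [x * z] is an idempotent, [x] is invertible with inverse
    [z] on its image and nilpotent on the image of [1 - x * z]. Being
    described by equations, it is preserved by morphisms. *)
Definition drazin (x z : deg0 D) :=
  x * z * z = z /\ exists m, x ^+ m.+1 * z = x ^+ m.

Lemma drazin_exists x : exists z, drazin x z.
Proof.
have [N [m [a xm]]] := finite_dim_dependent (fun i => x ^+ i : deg0 D) fdD.
pose y := \sum_(i < N | (m < i)%N) a i *: x ^+ (i - m.+1).
have {}xm : x ^+ m = x ^+ m.+1 * y.
  rewrite xm mulr_sumr; apply: eq_bigr => i mi.
  by rewrite -scale0Ar -exprD subnKC.
have xmj j : x ^+ m = x ^+ (m + j) * y ^+ j.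
  elim: j => [|j IH]; first by rewrite addn0 mulr1.
  by rewrite {1}xm exprS {1}IH addnS !exprS; ring.
(* On the ideal of [x ^+ m] the element [y] inverts [x], and [x ^+ m * y ^+ m]
   is the idempotent that generates this ideal. *)
exists (x ^+ m * y ^+ m.+1); split; last first.
  by exists m; rewrite mulrA -exprD addSnnS -xmj.
have -> : x * (x ^+ m * y ^+ m.+1) * (x ^+ m * y ^+ m.+1) =
    x ^+ (m + m.+1) * y ^+ m.+1 * y ^+ m.+1.
  by rewrite -addSnnS exprD [x ^+ m.+1]exprS; ring.
by rewrite -xmj.
Qed.

(** If [t] and [t'] are two such inverses of [y], the idempotent [y * t] is
    divisible by all powers of [y], while [1 - y * t'] is killed by one of
    them; hence [y * t] absorbs [y * t'], and by symmetry they are equal. *)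
Lemma drazin_unique x z z' : drazin x z -> drazin x z' -> z = z'.
Proof.
have absorb y t t' : drazin y t -> drazin y t' -> y * t * (y * t') = y * t.
  move=> [yt _] [_ [m yt']].
  have yty : y * t * (t * y) = y * t by rewrite mulrA yt mulrC.
  have -> : y * t = y * t * t ^+ m * y ^+ m.
    elim: m {yt'} => [|m IH]; first by rewrite !mulr1.
    by rewrite {1}IH -{1}yty !exprS; ring.
  by rewrite -[in RHS]yt' exprS; ring.
move=> zP z'P.
have xz : x * z = x * z' by rewrite -(absorb _ _ _ zP z'P) mulrC (absorb _ _ _ z'P zP).
by rewrite -zP.1 xz mulrAC xz z'P.1.
Qed.
End FiniteDimensional.
Arguments drazin {k D} x z.

Lemma drazin_mor (k : fieldType) (D E : tdga k) (f : tdga_mor D E) x z :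
  drazin x z -> drazin (mor_deg0 f x) (mor_deg0 f z).
Proof.
move=> [xzz [m xm]]; split; first by rewrite -!rmorphM xzz.
by exists m; rewrite -!rmorphXn -rmorphM xm.
Qed.

(** * Limits of finite-dimensional algebras *)

Section Limit.
Context (k : fieldType) (C : category) (D : diagram k C) (A : tdga k)
  (pi : forall c, tdga_mor A (D c)).
Hypothesis limA : is_limit pi.

Lemma limit_compat (a b : C) (u : hom a b) n (x : A n) :
  dmor D u n (pi a n x) = pi b n x.
Proof. by case: limA. Qed.

Lemma limit_eq n (x y : A n) : (forall c, pi c n x = pi c n y) -> x = y.
Proof.
move=> xy; have [_ ex _] := limA.
have [|z [_ zu]] := ex n (fun c => pi c n x).
  by move=> a b u; exact: limit_compat.
by rewrite -(zu x) // -(zu y) // => c; rewrite xy.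
Qed.

Lemma limit_ex n (y : forall c, D c n) :
  (forall (a b : C) (u : hom a b), dmor D u n (y a) = y b) ->
  exists x, forall c, pi c n x = y c.
Proof. by have [_ ex _] := limA => /ex [x [xP _]]; exists x. Qed.

Lemma limit_continuous (T : topologicalType) n (h : T -> A n) :
  (forall c, continuous (pi c n \o h)) -> continuous h.
Proof.
move=> hc; have [_ _ top] := limA.
apply/continuousP => U /top [V oV <-].
suff /continuousP : continuous
    (fun t => (fun c => pi c n (h t)) : prod_topology (fun c => D c n)) by apply.
by apply: prod_continuous => c; exact: hc.
Qed.

Lemma deg0_limit_eq (x y : deg0 A) :
  (forall c, mor_deg0 (pi c) x = mor_deg0 (pi c) y) -> x = y.
Proof. exact: limit_eq. Qed.

Lemma deg0_limit_ex (y : forall c, deg0 (D c)) :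
  (forall (a b : C) (u : hom a b), mor_deg0 (dmor D u) (y a) = y b) ->
  exists x : deg0 A, forall c, mor_deg0 (pi c) x = y c.
Proof. exact: limit_ex. Qed.

Lemma deg0_limit_compat (a b : C) (u : hom a b) (x : deg0 A) :
  mor_deg0 (dmor D u) (mor_deg0 (pi a) x) = mor_deg0 (pi b) x.
Proof. exact: limit_compat. Qed.

Hypothesis fdD : forall c, finite_dim_discrete (D c).

Lemma fd0 c : finite_dim (D c 0). Proof. by case: (fdD c). Qed.

(** Uniqueness in each [D c] makes the Drazin inverses a compatible family. *)
Lemma limit_drazin (x : deg0 A) : exists z, forall c,
  drazin (mor_deg0 (pi c) x) (mor_deg0 (pi c) z).
Proof.
have [y yP] := dep_choice (fun c => drazin_exists (fd0 c) (mor_deg0 (pi c) x)).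
have [|z zP] := deg0_limit_ex (y := y).
  move=> a b u; apply: (drazin_unique _ (yP b)).
  by rewrite -(deg0_limit_compat u); exact: drazin_mor.
by exists z => c; rewrite zP.
Qed.

(** In each [D c] the image of [S] has a least element, the image of some
    [f c] in [S]. For an arrow from [a] to [b], the product [f a * f b] has the
    least image both in [D a] and in [D b], which gives compatibility. *)
Lemma limit_idem_inf (S : set (deg0 A)) : S !=set0 ->
  (forall e, S e -> e * e = e) -> (forall e f, S e -> S f -> S (e * f)) ->
  exists2 e, (forall f, S f -> e * f = e) &
    forall c, exists2 f, S f & mor_deg0 (pi c) e = mor_deg0 (pi c) f.
Proof.
move=> [e0 Se0] idS mulS.
have minc c : exists f, S f /\ forall g, S g ->
    mor_deg0 (pi c) (f * g) = mor_deg0 (pi c) f.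
  have [||e [f Sf <-] fmin] :=
      idem_minimal (fd0 c) (S := mor_deg0 (pi c) @` S).
  - by exists (mor_deg0 (pi c) e0), e0.
  - by move=> _ [e Se <-]; rewrite -rmorphM idS.
  exists f; split => // g Sg; apply: fmin; first by exists (f * g) => //; exact: mulS.
  by rewrite -rmorphM mulrAC idS.
have {minc}[f fP] := choice minc.
have piE a b : mor_deg0 (pi a) (f a * f b) = mor_deg0 (pi a) (f a).
  by apply: (fP a).2; exact: (fP b).1.
have [|e eP] := deg0_limit_ex (y := fun c => mor_deg0 (pi c) (f c)).
  by move=> a b u; rewrite -(piE a b) deg0_limit_compat mulrC piE.
exists e; last by move=> c; exists (f c) => //; exact: (fP c).1.
move=> g Sg; apply: deg0_limit_eq => c.
by rewrite rmorphM /= eP -[RHS]((fP c).2 _ Sg) rmorphM.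
Qed.

End Limit.

(** * Maximal graded ideals *)

Section Ideals.
Context (k : fieldType) (A : tdga k).
Implicit Types S T : forall n, set (A n).

Lemma gmul_oner n (e : n + 0 = n) (x : A n) : gmul A e x (gone A) = x.
Proof. by rewrite (gmulC e (add0r n)) mulr0 expr0z scale1r gmul1. Qed.

Lemma idealZ S n c (x : A n) : graded_ideal S -> S n x -> S n (c *: x).
Proof.
move=> [_ _ SM] Sx; have := SM _ _ _ (add0r n) (c *: gone A) x Sx.
by rewrite gmulZl gmul1.
Qed.

Lemma ideal_mulr S m n p (e : n + m = p) (x : A n) (a : A m) :
  graded_ideal S -> S n x -> S p (gmul A e x a).
Proof.
move=> iS Sx; have e' : m + n = p by rewrite addrC.
by rewrite (gmulC e e'); apply: idealZ => //; case: iS => _ _; apply.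
Qed.

Lemma ideal_one S : graded_ideal S -> S 0 (gone A) -> forall n (x : A n), S n x.
Proof.
move=> [_ _ SM] S1 n x.
by have := SM _ _ _ (addr0 n) x _ S1; rewrite gmul_oner.
Qed.

Lemma proper_one S : proper_ideal S -> ~ S 0 (gone A).
Proof. by move=> [iS nS] S1; apply: nS; exact: ideal_one. Qed.

(** Zorn's lemma, applied to sets of homogeneous elements. The empty set is
    admitted because it is the union of the empty chain; it is not maximal, as
    it is contained in the principal ideal of [b]. *)
Lemma nonunit_maximal_ideal (b : deg0 A) : (forall y, b * y <> 1) ->
  exists S, maximal_ideal S /\ S 0 b.
Proof.
move=> nub.
pose fam (X : set {n : int & A n}) : forall n, set (A n) :=
  fun n x => X (existT _ n x).
pose tot S : set {n : int & A n} := fun z => S (projT1 z) (projT2 z).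
pose P : set (set {n : int & A n}) :=
  fun X => X = set0 \/ (proper_ideal (fam X) /\ fam X 0 b).
have [F FP totF|X [PX maxX]] := @Zorn_bigcup _ P.
  have [[X0 [FX0 [z0 X0z0]]]|F0] := pselect (exists X, F X /\ X !=set0); last first.
    left; apply/seteqP; split=> // z [X FX Xz]; apply: F0.
    by exists X; split => //; exists z.
  have FI X z : F X -> X z -> proper_ideal (fam X) /\ fam X 0 b.
    by move=> /FP[->|].
  have FU X Y : F X -> F Y -> exists2 Z, F Z & X `<=` Z /\ Y `<=` Z.
    move=> FX FY; have [XY|YX] := totF X Y FX FY.
      by exists Y => //; split => //; exact: subset_refl.
    by exists X => //; split => //; exact: subset_refl.
  right; split; last by exists X0 => //; case: (FI _ _ FX0 X0z0).
  split; first split.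
  - move=> n; exists X0 => //; have [[[Z _ _] _] _] := FI _ _ FX0 X0z0; exact: Z.
  - move=> n x y [X FX Xx] [Y FY Yy]; have [Z FZ [XZ YZ]] := FU X Y FX FY.
    exists Z => //; have [[[_ D _] _] _] := FI _ _ FZ (XZ _ Xx).
    by apply: D; [exact: XZ | exact: YZ].
  - move=> m n p e a x [X FX Xx]; exists X => //.
    by have [[[_ _ M] _] _] := FI _ _ FX Xx; exact: M.
  - move=> all; have [X FX X1] := all 0 (gone A).
    by have [pX _] := FI _ _ FX X1; exact: (proper_one pX).
have [X0|[pX Xb]] := PX.
  pose S n : set (A n) := [set x | exists y, x = act b y].
  have pS : proper_ideal S.
    split; last by move=> /(_ 0 (gone A)) [y]; rewrite act0E => /esym/nub.
    split.
    - by move=> n; exists 0; rewrite act0r.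
    - by move=> n _ _ [x ->] [y ->]; exists (x + y); rewrite actDr.
    - by move=> m n p e a _ [x ->]; exists (gmul A e a x); rewrite act_mulr.
  exfalso; apply: (maxX (tot S)).
    rewrite X0; split; first by move=> z.
    move=> /(_ (existT (fun n : int => A n) (0 : int) 0)) []; exists 0.
    by rewrite act0r.
  by right; split; [exact: pS | exists (gone A); rewrite act0E mulr1].
exists (fam X); split => //; split => // S pS XS n x Sx.
apply: contrapT => nXx; apply: (maxX (tot S)).
  split; first by case=> m y; exact: XS.
  by move=> /(_ (existT _ n x) Sx).
by right; split; [exact: pS | exact: XS].
Qed.

(** If [a] is neither 0 nor 1, then [a] and [1 - a] are not units; the unique
    maximal ideal would contain both, hence their sum 1. *)
Lemma unique_maximal_idem (a : deg0 A) :
  (exists! S : (forall n, set (A n)), maximal_ideal S) -> a * a = a ->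
  a = 0 \/ a = 1.
Proof.
move=> [S0 [_ S0u]] aa; apply: contrapT => /not_orP[a0 a1].
have [y ay|S [mS Sa]] := nonunit_maximal_ideal (b := a).
  by apply: a1; rewrite -[LHS]mulr1 -ay mulrA aa.
have [y ay|T [mT Ta]] := nonunit_maximal_ideal (b := 1 - a).
  by apply: a0; rewrite -[a]mulr1 -ay mulrA mulrBr mulr1 aa subrr mul0r.
have [pS _] := mS; apply: (proper_one pS).
have ST : S = T by rewrite -(S0u S mS) -(S0u T mT).
have [[_ D _] _] := pS; have : S 0 (a + (1 - a)) by apply: D => //; rewrite ST.
by rewrite addrC subrK.
Qed.

Definition nonunits n : set (A n) :=
  fun x => forall m (e : n + m = 0) (y : A m), gmul A e x y <> gone A.

Lemma proper_nonunits S n : proper_ideal S -> S n `<=` @nonunits n.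
Proof.
move=> pS x Sx m e y xy; apply: (proper_one pS); rewrite -xy.
by apply: ideal_mulr => //; case: pS.
Qed.

Hypothesis one_neq0 : (1 : deg0 A) <> 0.
Hypothesis unit_or : forall x : deg0 A,
  (exists y, x * y = 1) \/ (exists y, (1 - x) * y = 1).

(** If [x + y] has the inverse [w], then [x * w] and [y * w] are elements of
    degree zero with sum 1, so that one of them is a unit, and [x] or [y] is a
    unit. *)
Lemma nonunits_ideal : proper_ideal nonunits.
Proof.
split; first split.
- move=> n m e y; rewrite gmul0l => /esym; exact: one_neq0.
- move=> n x y Nx Ny m e w; rewrite gmulDl => xyw.
  pose u : deg0 A := gmul A e x w; pose v : deg0 A := gmul A e y w.
  have vE : 1 - u = v by rewrite -gone0E -xyw -/u -/v addrC addKr.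
  case: (unit_or u) => -[t].
    rewrite mulrC -act0E -act_mulr; exact: Nx.
  rewrite vE mulrC -act0E -act_mulr; exact: Ny.
- move=> m n p e a x Nx l e' y axy; have en : n + m = p by rewrite addrC.
  have eml : m + l = - n by apply/eqP; rewrite -addr_eq0 addrC addrA en e'.
  have e'' : n + (- n) = 0 by rewrite subrr.
  have : gmul A e' (gmul A en x a) y = (-1) ^ (n * m) *: gone A.
    by rewrite (gmulC en e) gmulZl axy.
  rewrite (gmulA en e' eml e'') => xay.
  apply: (Nx _ e'' ((-1) ^ (n * m) *: gmul A eml a y)).
  by rewrite gmulZr xay scalerA -expfzMl mulrNN mulr1 exp1rz scale1r.
- move=> all; apply: (all 0 (gone A) 0 (addr0 0) (gone A)); exact: gmul1.
Qed.

Lemma nonunits_maximal : maximal_ideal nonunits.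
Proof. by split=> [|S pS _ n]; [exact: nonunits_ideal | exact: proper_nonunits]. Qed.

Lemma maximal_nonunits S : maximal_ideal S -> S = nonunits.
Proof.
move=> [pS maxS]; apply: functional_extensionality_dep => n; apply/seteqP.
split; first exact: proper_nonunits.
apply: maxS; first exact: nonunits_ideal.
by move=> m; exact: proper_nonunits.
Qed.

(** If [d] does not preserve the non-units, some [d x] has an inverse [y]. From
    [0 = d 1 = d (d x * y)] the inverse [y] is a cycle, so [d (x * y) = 1]; a
    cycle [w] is then the boundary of [x * y * w]. *)
Lemma hinich_or_acyclic : pseudo_compact A -> hinich A \/ acyclic A.
Proof.
move=> pcA; have locA : local_pc A.
  split=> //; exists nonunits; split; first exact: nonunits_maximal.
  by move=> S /maximal_nonunits.
case: (pselect (forall m n (e : m = n + 1) (x : A m),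
    nonunits x -> nonunits (gdiff A e x))) => [dN|dN]; [left|right]; split => //.
  by move=> S /maximal_nonunits -> m n e x; exact: dN.
have [m [n [e [x [p [enp [y xy]]]]]]] : exists m n (e : m = n + 1) (x : A m)
    p (enp : n + p = 0) (y : A p), gmul A enp (gdiff A e x) y = gone A.
  apply: contrapT => nex; apply: dN => m n e x _ p enp y xy; apply: nex.
  by exists m, n, e, x, p, enp, y.
pose u := gdiff A e x.
have e0 : 0 = -1 + 1 :> int by rewrite addNr.
have en : n = n - 1 + 1 by rewrite subrK.
have ep : p = p - 1 + 1 by rewrite subrK.
have el : n - 1 + p = -1 by rewrite addrAC enp sub0r.
have er : n + (p - 1) = -1 by rewrite addrA enp sub0r.
have u_dy : gmul A er u (gdiff A ep y) = 0.
  have := gdiff_mul enp en ep e0 el er u y.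
  rewrite xy (gdiff_idem e0 (mulr1 (1 : deg0 A))) gdiff_diff gmul0l add0r.
  move=> /(congr1 ( *:%R ((-1) ^ n))).
  by rewrite scaler0 scalerA -expfzMl mulrNN mulr1 exp1rz scale1r.
(* Multiplying [d x * d y = 0] by the inverse [y] of [d x]. *)
have dy : gdiff A ep y = 0.
  have epn : p + n = 0 by rewrite addrC.
  have := gmulA epn (add0r (p - 1)) er (erefl (p + -1)) y u (gdiff A ep y).
  rewrite u_dy gmul0r (gmulC epn enp) xy gmulZl gmul1.
  move=> /(congr1 ( *:%R ((-1) ^ (p * n)))).
  by rewrite scaler0 scalerA -expfzMl mulrNN mulr1 exp1rz scale1r.
have emp : m + p = 1 by rewrite e addrAC enp add0r.
pose s := gmul A emp x y.
have e1 : 1 = 0 + 1 :> int by rewrite add0r.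
have ds : gdiff A e1 s = gone A.
  have er' : m + (p - 1) = 0 by rewrite addrA emp subrr.
  by rewrite /s (gdiff_mul emp e ep e1 enp er') dy gmul0r scaler0 addr0.
move=> q r l eq el' w dw.
have e1q : 1 + q = l by rewrite addrC.
exists (gmul A e1q s w).
have e1r : 1 + r = q by rewrite addrC.
by rewrite (gdiff_mul e1q e1 eq el' (add0r q) e1r) ds dw gmul0r scaler0 addr0 gmul1.
Qed.

End Ideals.

(** * Corners at idempotents of degree zero *)

Section CornerModule.
Context (k : fieldType) (A : tdga k) (a : deg0 A) (n : int).

Definition fixed : {pred A n} := fun x => `[< act a x = x >].

Lemma fixedP x : reflect (act a x = x) (x \in fixed).
Proof. exact: asboolP. Qed.

Lemma fixed_submod : GRing.submod_closed fixed.
Proof.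
split; first by apply/fixedP; rewrite act0r.
move=> c x y /fixedP ax /fixedP ay; apply/fixedP.
by rewrite actDr actZr ax ay.
Qed.

HB.instance Definition _ := GRing.isSubmodClosed.Build k (A n) fixed fixed_submod.

(** The part [a A] of [A], for an idempotent [a]: membership in the image of the
    projection is expressed by the linear equation of its fixed points. *)
Record corner_comp := CornerComp { corner_val : A n; _ : corner_val \in fixed }.

HB.instance Definition _ := [isSub for corner_val].
HB.instance Definition _ := [Choice of corner_comp by <:].
HB.instance Definition _ := [SubChoice_isSubLmodule of corner_comp by <:].
HB.instance Definition _ :=
  Topological.copy corner_comp (initial_topology corner_val).
End CornerModule.

Arguments corner_val {k A a n} x : rename.

Section Corner.
Context (k : fieldType) (A : tdga k) (a : deg0 A).
Local Notation V := (corner_comp a).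

Lemma corner_valP n (x : V n) : act a (corner_val x) = corner_val x.
Proof. exact/fixedP/(valP x). Qed.

Lemma corner_val_inj n : injective (@corner_val k A a n).
Proof. exact: val_inj. Qed.

Lemma corner_valZ n c (x : V n) : corner_val (c *: x) = c *: corner_val x.
Proof. by rewrite -[corner_val _]/(\val _) linearZ. Qed.

Lemma corner_valD n (x y : V n) : corner_val (x + y) = corner_val x + corner_val y.
Proof. by rewrite -[corner_val _]/(\val _) raddfD. Qed.

Lemma corner_val_sum n (I : Type) (r : seq I) (P : pred I) (F : I -> V n) :
  corner_val (\sum_(i <- r | P i) F i) = \sum_(i <- r | P i) corner_val (F i).
Proof. exact: (big_morph _ (@corner_valD n) (erefl : corner_val 0 = 0 :> A n)). Qed.

Lemma corner_val_continuous n : continuous (@corner_val k A a n).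
Proof. exact: initial_continuous. Qed.

Lemma corner_continuous (T : topologicalType) n (h : T -> V n) :
  continuous (fun t => corner_val (h t)) -> continuous h.
Proof.
move=> /continuousP hc; apply/continuousP => _ [U oU <-]; exact: hc.
Qed.

Hypothesis aa : a * a = a.

Lemma act_idem n (x : A n) : act a x \in fixed a (n:=n).
Proof. by apply/fixedP; rewrite -actM aa. Qed.

Definition corner_proj n (x : A n) : V n := CornerComp (act_idem x).

Definition corner_mul m n p (e : m + n = p) (x : V m) (y : V n) : V p.
Proof.
exists (gmul A e (corner_val x) (corner_val y)).
by apply/fixedP; rewrite -act_mull corner_valP.
Defined.

Definition corner_one : V 0.
Proof. by exists a; apply/fixedP; rewrite act0E. Defined.

Definition corner_diff m n (e : m = n + 1) (x : V m) : V n.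
Proof.
exists (gdiff A e (corner_val x)).
by apply/fixedP; rewrite -gdiff_act // corner_valP.
Defined.

(** The dg algebra [a A]; its unit is [a], and [d] preserves it because [a] is a
    cycle. *)
Definition corner : tdga k.
Proof.
apply: (@Tdga k (fun n => V n) corner_mul corner_one corner_diff).
- by move=> m n p e y c x x'; apply: corner_val_inj; exact: gmul_linearl.
- by move=> m n p e x c y y'; apply: corner_val_inj; exact: gmul_linearr.
- by move=> *; apply: corner_val_inj; exact: gmulA.
- by move=> n e x; apply: corner_val_inj; rewrite /= gmul_act corner_valP.
- by move=> *; apply: corner_val_inj; exact: gmulC.
- by move=> m n e c x x'; apply: corner_val_inj; exact: gdiff_linear.
- by move=> *; apply: corner_val_inj; exact: gdiff_diff.
- by move=> *; apply: corner_val_inj; exact: gdiff_mul.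
Defined.

End Corner.

Section CornerMor.
Context (k : fieldType) (A B : tdga k) (f : tdga_mor A B).
Context (a : deg0 A) (b : deg0 B) (aa : a * a = a) (bb : b * b = b).
Hypothesis fab : mor_deg0 f a = b.

Definition corner_map n (x : corner_comp a n) : corner_comp b n.
Proof.
exists (f n (corner_val x)).
by apply/fixedP; rewrite -fab -mor_act corner_valP.
Defined.

Definition corner_mor : tdga_mor (corner aa) (corner bb).
Proof.
apply: (@TdgaMor k (corner aa) (corner bb) corner_map).
- by move=> n c x y; apply: corner_val_inj; exact: mor_linear.
- by move=> *; apply: corner_val_inj; exact: mor_mul.
- by apply: corner_val_inj; exact: fab.
- by move=> *; apply: corner_val_inj; exact: mor_diff.
- move=> n; apply: corner_continuous => x.
  by apply: continuous_comp; [exact: corner_val_continuous | exact: mor_continuous].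
Defined.
End CornerMor.

Lemma corner_idem_val (k : fieldType) (A : tdga k) (a : deg0 A) (aa : a * a = a)
  (b : deg0 (corner aa)) : b * b = b ->
  let v : deg0 A := corner_val b in v * v = v /\ a * v = v.
Proof.
move=> bb v; split; last by rewrite -act0E corner_valP.
exact: (congr1 (@corner_val _ _ _ _) bb).
Qed.

(** * Corners of pseudo-compact algebras *)

Section LimitCorner.
Context (k : fieldType) (C : category) (D : diagram k C) (A : tdga k)
  (pi : forall c, tdga_mor A (D c)).
Hypothesis limA : is_limit pi.
Hypothesis fdD : forall c, finite_dim_discrete (D c).

(** With [z] the Drazin inverse of [x], the idempotent [x * z] is 1, and then
    [x] is a unit, or 0, and then [x] is nilpotent in each [D c]. In the second
    case [1 - x] is a unit in each [D c], so it cannot be nilpotent there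
    unless [D c] vanishes, which cannot happen for all [c]. *)
Lemma limit_unit_or :
  (1 : deg0 A) <> 0 -> (forall e : deg0 A, e * e = e -> e = 0 \/ e = 1) ->
  forall x : deg0 A, (exists y, x * y = 1) \/ (exists y, (1 - x) * y = 1).
Proof.
move=> A1 idA.
have unit_or_nil (x : deg0 A) : (exists y, x * y = 1) \/
    forall c, exists m, mor_deg0 (pi c) x ^+ m = 0.
  have [z zP] := limit_drazin limA fdD x.
  have xzz : x * z * z = z.
    by apply: (deg0_limit_eq limA) => c; rewrite !rmorphM /=; case: (zP c).
  have [|xz0|xz1] := idA (x * z).
    by rewrite -[in RHS]xzz; ring.
    right=> c; have [_ [m zm]] := zP c; exists m.
    by rewrite -zm exprSr -mulrA -rmorphM xz0 rmorph0 mulr0.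
  by left; exists z.
move=> x; have [|xnil] := unit_or_nil x; first by left.
have [|ynil] := unit_or_nil (1 - x); first by right.
exfalso; apply: A1; apply: (deg0_limit_eq limA) => c.
have [m xm] := xnil c; have [m' ym] := ynil c.
pose u := mor_deg0 (pi c) x.
have {ym}ym : (1 - u) ^+ m' = 0 by rewrite -ym rmorphB rmorph1.
have uu : (1 - u) * (\sum_(i < m) u ^+ i) = 1.
  by rewrite -opprB mulNr -subrX1 /u xm sub0r opprK.
by rewrite rmorph0 rmorph1 -(expr1n _ m') -uu exprMn ym mul0r.
Qed.

Section CornerDiagram.
Context (a : deg0 A) (aa : a * a = a).

Lemma mor_idem c : mor_deg0 (pi c) a * mor_deg0 (pi c) a = mor_deg0 (pi c) a.
Proof. by rewrite -rmorphM aa. Qed.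

Definition corner_diagram : diagram k C.
Proof.
apply: (@Diagram k C (fun c => corner (mor_idem c))
  (fun c c' u => corner_mor (mor_idem c) (mor_idem c') (deg0_limit_compat limA u a))).
- by move=> c n x; apply: corner_val_inj; exact: dmor1.
- by move=> c1 c2 c3 u v n x; apply: corner_val_inj; exact: dmor_comp.
Defined.

Definition corner_pi c : tdga_mor (corner aa) (corner_diagram c) :=
  corner_mor aa (mor_idem c) (erefl _).

Lemma finite_dim_corner c : finite_dim_discrete (corner_diagram c).
Proof.
have [fd [N bd] disc] := fdD c; split.
- move=> n; have [r [b bP]] := fd n.
  exists r, (fun i => corner_proj (mor_idem c) (b i)) => x.
  have [d dP] := bP (corner_val x); exists d; apply: corner_val_inj.
  rewrite -corner_valP dP act_sumr [RHS]corner_val_sum.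
  by apply: eq_bigr => i _; rewrite actZr [RHS]corner_valZ.
- by exists N => n Nn x; apply: corner_val_inj; rewrite (bd n Nn (corner_val x)).
- move=> n U; exists (@corner_val _ _ _ _ @` U); first exact: disc.
  by apply/seteqP; split=> [x [y Uy /corner_val_inj <-]//|x Ux]; exists x.
Qed.

(** A compatible family in the corners [pi c a (D c)] is the image of a unique
    element of [A], which is fixed by [a] because all its images are; the
    topology is initial for the projections by transitivity. *)
Lemma limit_corner : is_limit corner_pi.
Proof.
split.
- by move=> c c' u n x; apply: corner_val_inj; exact: (limit_compat limA).
- move=> n y yP; have [|x xP] := limit_ex limA (y := fun c => corner_val (y c)).
    by move=> c c' u; rewrite -(yP _ _ u).
  have ax : x \in fixed a (n:=n).
    apply/fixedP/(limit_eq limA) => c.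
    by rewrite mor_act xP corner_valP.
  exists (CornerComp ax); split; first by move=> c; apply: corner_val_inj; exact: xP.
  move=> z zP; apply/corner_val_inj/(limit_eq limA) => c.
  by rewrite /= xP -zP.
- move=> n U; pose prodT := prod_topology (fun c => corner_diagram c n).
  split.
    move=> oU.
    pose T' := initial_topology
      (fun x : corner aa n => (fun c => corner_pi c n x) : prodT).
    suff : continuous (id : T' -> corner aa n) by move=> /continuousP; apply.
    apply: corner_continuous; apply: (limit_continuous limA) => c.
    have -> : pi c n \o (fun t : T' => corner_val (t : corner aa n)) =
      @corner_val _ _ _ _ \o ((fun x : prodT => x c) \o
        ((fun x : corner aa n => (fun c => corner_pi c n x) : prodT) : T' -> _)).
      by [].
    move=> x; apply: continuous_comp; last exact: corner_val_continuous.
    apply: continuous_comp; first exact: initial_continuous.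
    exact: prod_eval_continuous.
  move=> [V oV <-].
  suff /continuousP : continuous
      (fun x : corner aa n => (fun c => corner_pi c n x) : prodT) by apply.
  by apply: prod_continuous => c; exact: mor_continuous.
Qed.

Lemma pseudo_compact_corner : pseudo_compact (corner aa).
Proof.
exists C, corner_diagram, corner_pi.
by split; [exact: finite_dim_corner | exact: limit_corner].
Qed.

End CornerDiagram.
End LimitCorner.

(** * Decomposition along primitive idempotents *)

Definition primitive (k : fieldType) (A : tdga k) (e : deg0 A) :=
  [/\ e * e = e, e <> 0 &
      forall f : deg0 A, f * f = f -> e * f = f -> f = 0 \/ f = e].

Section Primitive.
Context (k : fieldType) (A : tdga k).
Implicit Types e f : deg0 A.

Lemma primitive_idem e : primitive e -> e * e = e. Proof. by case. Qed.

Lemma primitive_orth e f : primitive e -> primitive f -> e <> f -> e * f = 0.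
Proof.
move=> [ee e0 eP] [ff f0 fP] ef.
have idem_ef : e * f * (e * f) = e * f by rewrite mulrACA ee ff.
have [|//|efe] := eP (e * f) idem_ef; first by rewrite mulrA ee.
have [|//|eff] := fP (e * f) idem_ef; first by rewrite mulrCA ff.
by case: ef; rewrite -efe.
Qed.

Lemma corner_idem e (pe : primitive e) (b : deg0 (corner (primitive_idem pe))) :
  b * b = b -> b = 0 \/ b = 1.
Proof.
move=> bb; have [vv ev] := corner_idem_val bb; have [_ _ eP] := pe.
by have [v0|ve] := eP _ vv ev; [left|right]; apply: corner_val_inj.
Qed.

Lemma corner_one_neq0 e (pe : primitive e) :
  (1 : deg0 (corner (primitive_idem pe))) <> 0.
Proof. by have [_ e0 _] := pe => /(congr1 (@corner_val _ _ _ _)) /e0. Qed.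

End Primitive.

Lemma idem_compl (R : pzRingType) (e : R) : e * e = e ->
  (1 - e) * (1 - e) = 1 - e.
Proof. by move=> ee; rewrite mulrBr mulr1 mulrBl mul1r ee subrr subr0. Qed.

Section Decomposition.
Context (k : fieldType) (C : category) (D : diagram k C) (A : tdga k)
  (pi : forall c, tdga_mor A (D c)).
Hypothesis limA : is_limit pi.
Hypothesis fdD : forall c, finite_dim_discrete (D c).
Local Notation pi0 c := (mor_deg0 (pi c)).

(** Let [p] be a minimal nonzero idempotent below [q]. The infimum [e] of the
    idempotents of [A] whose image lies above [p] has an image above [p], since
    infima are computed in each [D c]. It is primitive: for an idempotent [f]
    below [e], the image of [f] or that of [e - f] lies above [p]. *)
Lemma primitive_meets c (q : deg0 (D c)) : q * q = q -> q <> 0 ->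
  exists2 e : deg0 A, primitive e & pi0 c e * q <> 0.
Proof.
move=> qq q0.
have [|p [pp [p0 qp]]|p [pp [p0 qp]] pmin] :=
  idem_minimal (fd0 fdD c) (S := fun p => p * p = p /\ p <> 0 /\ q * p = p).
- by exists q.
- by [].
pose S : set (deg0 A) := fun e => e * e = e /\ pi0 c e * p = p.
have [|e []//|e f [ee ep] [ff fp]|e einf elim] := limit_idem_inf limA fdD (S := S).
- by exists 1; split; rewrite ?rmorph1 mul1r.
- by split; [rewrite mulrACA ee ff | rewrite rmorphM -mulrA /= fp].
have ee : e * e = e.
  apply: (deg0_limit_eq limA) => c'; rewrite rmorphM /=.
  by have [f [ff _] ->] := elim c'; rewrite -rmorphM ff.
have ep : pi0 c e * p = p by have [f [_ fp] ->] := elim c.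
exists e; last first.
  move=> eq; apply: p0; rewrite -ep -qp mulrA eq mul0r //.
split => //.
  by move=> e0; apply: p0; rewrite -ep e0 rmorph0 mul0r.
move=> f ff ef.
have [fp0|fp] := pselect (pi0 c f * p = 0); [left|right].
  have : S (e - f).
    split; last by rewrite rmorphB /= mulrBl ep fp0 subr0.
    by rewrite mulrBr !mulrBl ee ff ef [f * e]mulrC ef subrr subr0.
  move=> /einf; rewrite mulrBr ee ef => /(canRL (subrK _)).
  by rewrite -[LHS]addr0 => /addrI/esym.
have Sf : S f.
  split=> //; apply: pmin; last by rewrite -mulrA pp.
  split; first by rewrite mulrACA -rmorphM ff pp.
  by split => //; rewrite mulrCA qp.
by rewrite -(einf f Sf) ef.
Qed.

(** Among the images of the products of complements [1 - e] of primitive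
    idempotents there is a minimal one [q]. It is orthogonal to the image of
    every primitive idempotent, hence zero by [primitive_meets]. *)
Lemma primitive_cover c : exists s : seq (deg0 A),
  (forall e, e \in s -> primitive e) /\ \prod_(e <- s) (1 - pi0 c e) = 0.
Proof.
pose S : set (deg0 (D c)) := fun q => exists s : seq (deg0 A),
  (forall e, e \in s -> primitive e) /\ \prod_(e <- s) (1 - pi0 c e) = q.
have idS q : S q -> q * q = q.
  move=> [s [sP <-]]; elim: s sP => [|e s IH] sP; first by rewrite big_nil mulr1.
  rewrite big_cons mulrACA IH => [|f fs]; last by apply: sP; rewrite inE fs orbT.
  by rewrite idem_compl // -rmorphM (primitive_idem (sP e _)) // inE eqxx.
have [|q [s [sP sq]] qmin] := idem_minimal (fd0 fdD c) _ idS.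
  by exists 1, [::]; rewrite big_nil.
exists s; split => //; rewrite sq; apply: contrapT => q0.
have Sq : S q by exists s.
have [e pe] := primitive_meets (idS q Sq) q0; apply.
have : (1 - pi0 c e) * q = q; last first.
  rewrite mulrBl mul1r => /(canRL (subrK _)).
  by rewrite -[LHS]addr0 => /addrI.
apply: qmin; last by rewrite -mulrA idS.
exists (e :: s); rewrite big_cons sq; split=> // f.
by rewrite inE => /orP[/eqP ->|/sP].
Qed.

Lemma prod_compl_act c n (s : seq (deg0 A)) (z : D c n) :
  (forall e, e \in s -> act (pi0 c e) z = 0) ->
  act (\prod_(e <- s) (1 - pi0 c e)) z = z.
Proof.
elim: s => [|e s IH] sz; first by rewrite big_nil act1.
rewrite big_cons actM IH => [|f fs]; last by apply: sz; rewrite inE fs orbT.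
by rewrite actBl act1 sz ?subr0 // inE eqxx.
Qed.

Lemma cover_eq c n (s : seq (deg0 A)) (x y : D c n) :
  \prod_(e <- s) (1 - pi0 c e) = 0 ->
  (forall e, e \in s -> act (pi0 c e) x = act (pi0 c e) y) -> x = y.
Proof.
move=> s0 xy; apply: subr0_eq; rewrite -[LHS](prod_compl_act (s := s)) ?s0 ?act0l //.
by move=> e es; rewrite actBr xy // subrr.
Qed.

Definition primitive_factor (e : {e : deg0 A | primitive e}) : tdga k :=
  corner (primitive_idem (svalP e)).

Definition to_factors : tdga_mor A (prod_tdga primitive_factor).
Proof.
apply: (@TdgaMor k A (prod_tdga primitive_factor)
  (fun n x e => corner_proj (primitive_idem (svalP e)) x)).
- move=> n c x y; apply: functional_extensionality_dep => e.
  by apply: corner_val_inj; exact: gmul_linearr.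
- move=> m n p eq x y; apply: functional_extensionality_dep => e.
  apply: corner_val_inj => /=.
  by rewrite act_mull act_mulr -actM primitive_idem //; exact: (svalP e).
- apply: functional_extensionality_dep => e; apply: corner_val_inj => /=.
  by rewrite act0E mulr1.
- move=> m n eq x; apply: functional_extensionality_dep => e.
  apply: corner_val_inj => /=; rewrite gdiff_act //.
  exact: primitive_idem (svalP e).
- move=> n; apply: prod_continuous => e; apply: corner_continuous.
  apply: (limit_continuous limA) => c.
  have -> : pi c n \o
      (fun t : A n => corner_val (corner_proj (primitive_idem (svalP e)) t)) =
     (fun t => act (pi0 c (sval e)) t) \o pi c n.
    by apply/funext => t /=; rewrite mor_act.
  move=> t; apply: continuous_comp; first exact: mor_continuous.
  by apply: discrete_continuous; case: (fdD c).
Defined.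

(** In each [D c] the element is a finite sum of the given components, over the
    primitive idempotents that cover 1 there; the remaining components vanish
    in [D c]. Uniqueness ([cover_eq]) makes the sums compatible. *)
Lemma factors_glue n (y : prod_tdga primitive_factor n) :
  exists x : A n, forall e, act (sval e) x = corner_val (y e).
Proof.
(* The component at [e], extended by zero to all elements of degree zero. *)
pose Y (e : deg0 A) : A n :=
  if pselect (primitive e) is left pe then corner_val (y (exist _ e pe)) else 0.
have YE e : Y (sval e) = corner_val (y e).
  case: e => e pe; rewrite /Y /=; case: pselect => // pe'.
  by rewrite (Prop_irrelevance pe pe').
have eY e : primitive e -> act e (Y e) = Y e.
  by move=> pe; rewrite -[e]/(sval (exist _ e pe)) YE corner_valP.
have local c : exists x : D c n,
    forall e, primitive e -> act (pi0 c e) x = pi c n (Y e).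
  have [s [sP s1]] := primitive_cover c.
  exists (pi c n (\sum_(e <- undup s) Y e)) => e pe.
  rewrite -mor_act act_sumr.
  have [es|es] := boolP (e \in s).
    rewrite (bigD1_seq e) ?mem_undup ?undup_uniq //= eY // big_seq_cond big1 ?addr0 //.
    move=> f; rewrite mem_undup => /andP[/sP pf fe].
    rewrite -(eY f) // -actM primitive_orth ?act0l // => ef.
    by rewrite ef eqxx in fe.
  have off f : f \in s -> e * f = 0.
    move=> fs; apply: primitive_orth => //; first exact: sP.
    by move=> ef; rewrite ef fs in es.
  rewrite big_seq big1 => [|f]; last first.
    by rewrite mem_undup => fs; rewrite -(eY f (sP f fs)) -actM off // act0l.
  rewrite mor0; apply/esym; rewrite -[LHS](prod_compl_act (s := s)) ?s1 ?act0l //.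
  by move=> f fs; rewrite -(eY e pe) -mor_act -actM mulrC off // act0l mor0.
have [x xP] := dep_choice local.
have [|z zP] := limit_ex limA (y := x).
  move=> a b u; have [s [sP s1]] := primitive_cover b.
  apply: (cover_eq s1) => e /sP pe.
  rewrite xP // -(limit_compat limA u) -(xP a) // mor_act.
  by rewrite deg0_limit_compat.
exists z => e; apply: (limit_eq limA) => c.
by rewrite mor_act zP xP ?YE //; exact: (svalP e).
Qed.

Lemma act_primitive_eq n (x y : A n) :
  (forall e, primitive e -> act e x = act e y) -> x = y.
Proof.
move=> xy; apply: (limit_eq limA) => c; have [s [sP s0]] := primitive_cover c.
by apply: (cover_eq s0) => e /sP pe; rewrite -!mor_act xy.
Qed.

(** The image of [g y] in [D c] only depends on the finitely many components of
    [y] at the primitive idempotents that cover 1 in [D c]. *)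
Lemma glue_continuous n (g : prod_tdga primitive_factor n -> A n) :
  (forall y e, act (sval e) (g y) = corner_val (y e)) -> continuous g.
Proof.
move=> gP; apply: (limit_continuous limA) => c y U /nbhs_singleton Uy.
have [s [sP s0]] := primitive_cover c.
pose Q (e : deg0 A) : set (prod_tdga primitive_factor n) := fun y' =>
  act (pi0 c e) (pi c n (g y')) = act (pi0 c e) (pi c n (g y)).
have QF e : e \in s -> nbhs y (Q e).
  move=> /sP pe; pose i : {e | primitive e} := exist _ e pe.
  have cQ : continuous
      (fun y' : prod_tdga primitive_factor n => pi c n (corner_val (y' i))).
    move=> y'; apply: (@continuous_comp _ _ _
      (fun y' : prod_tdga primitive_factor n => corner_val (y' i) : A n) (pi c n));
      last exact: mor_continuous.
    apply: (@continuous_comp _ _ _ (fun y' : prod_tdga primitive_factor n => y' i)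
      (fun z : primitive_factor i n => corner_val z));
      last exact: corner_val_continuous.
    exact: prod_eval_continuous.
  have [_ _ disc] := fdD c.
  have : nbhs y [set y' | pi c n (corner_val (y' i)) = pi c n (corner_val (y i))].
    apply: (cQ y [set z | z = _]); apply: open_nbhs_nbhs; split => //.
  apply: filterS => y' /= yy'.
  by rewrite /Q -!mor_act -[e]/(sval i) !gP.
apply: filterS (near_seq (nbhs_filter y) QF) => y' Qy' /=.
by rewrite -[pi c n (g y')](_ : pi c n (g y) = _) //; apply: (cover_eq s0) => e /Qy'.
Qed.

Lemma factors_isomorphic : isomorphic A (prod_tdga primitive_factor).
Proof.
pose g n := projT1 (choice (@factors_glue n)).
have gP n y e : act (sval e) (g n y) = corner_val (y e).
  exact: (projT2 (choice (@factors_glue n))).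
have fg n : cancel (g n) (to_factors n).
  move=> y; apply: functional_extensionality_dep => e; apply: corner_val_inj.
  exact: gP.
have gf n : cancel (to_factors n) (g n).
  move=> x; apply: act_primitive_eq => e pe.
  by rewrite -[e]/(sval (exist _ e pe)) gP.
have finj n : injective (to_factors n) := can_inj (@gf n).
unshelve eexists to_factors,
  (@TdgaMor k (prod_tdga primitive_factor) A g _ _ _ _ _); last by split.
- by move=> n c x y; apply: finj; rewrite fg mor_linear !fg.
- by move=> m n p e x y; apply: finj; rewrite fg mor_mul !fg.
- by apply: finj; rewrite fg mor_one.
- by move=> m n e x; apply: finj; rewrite fg mor_diff fg.
- by move=> n; apply: glue_continuous => y e; exact: gP.
Qed.

Lemma primitive_corner_local (e : deg0 A) (pe : primitive e) :
  hinich (corner (primitive_idem pe)) \/ acyclic (corner (primitive_idem pe)).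
Proof.
have pc := pseudo_compact_corner limA fdD (primitive_idem pe).
have [C' [D' [pi' [fd' lim']]]] := pc.
apply: hinich_or_acyclic => //; first exact: corner_one_neq0.
apply: (limit_unit_or lim' fd'); first exact: corner_one_neq0.
exact: corner_idem.
Qed.

Lemma factor_hinich_or_acyclic e :
  hinich (primitive_factor e) \/ acyclic (primitive_factor e).
Proof. exact: primitive_corner_local. Qed.

End Decomposition.

(** * Morphisms between products *)

Lemma mor_ext (k : fieldType) (A B : tdga k) (f g : tdga_mor A B) :
  (forall n x, f n x = g n x) -> f = g.
Proof.
case: f g => [f f1 f2 f3 f4 f5] [g g1 g2 g3 g4 g5] /= fg.
have E : f = g.
  apply: functional_extensionality_dep => n.
  by apply: functional_extensionality_dep => x; exact: fg.
by case: _ / E in g1 g2 g3 g4 g5 *; congr TdgaMor; exact: Prop_irrelevance.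
Qed.

Definition comp_mor (k : fieldType) (A B C : tdga k)
  (g : tdga_mor B C) (f : tdga_mor A B) : tdga_mor A C.
Proof.
apply: (@TdgaMor k A C (fun n x => g n (f n x))).
- by move=> n c x y; rewrite !mor_linear.
- by move=> *; rewrite !mor_mul.
- by rewrite !mor_one.
- by move=> *; rewrite !mor_diff.
- by move=> n x; apply: continuous_comp; exact: mor_continuous.
Defined.

Section Products.
Context (k : fieldType) (I : Type) (A : I -> tdga k).
Local Notation P := (prod_tdga A).

Definition prod_proj i : tdga_mor P (A i).
Proof.
apply: (@TdgaMor k P (A i) (fun n x => x i)) => //.
by move=> n; exact: prod_eval_continuous.
Defined.

Definition prod_incl i n (a : A i n) : P n :=
  @dfwith {classic I} (fun i => A i n) (fun=> 0) i a.

Lemma prod_incl_same i n (a : A i n) : prod_incl a i = a.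
Proof. exact: (@dfwithin {classic I}). Qed.

Lemma prod_incl_other i j n (a : A i n) : i <> j -> prod_incl a j = 0.
Proof. by move=> ij; apply: (@dfwithout {classic I}); apply/eqP. Qed.

Lemma eq_prod_incl i n (a : A i n) (x : P n) :
  x i = a -> (forall j, i <> j -> x j = 0) -> x = prod_incl a.
Proof.
move=> xi xj; apply: functional_extensionality_dep => j.
have [ij|ij] := pselect (i = j); last by rewrite xj ?prod_incl_other.
by case: _ / ij; rewrite prod_incl_same.
Qed.

Lemma prod_incl_continuous i n : continuous (@prod_incl i n).
Proof.
apply: prod_continuous => j; have [ij|ij] := pselect (i = j).
  case: _ / ij; rewrite (_ : (fun a => _) = id) => [a|]; first exact: cvg_id.
  by apply/funext => a; exact: prod_incl_same.
rewrite (_ : (fun a => _) = cst 0); first exact: cst_continuous.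
by apply/funext => a; exact: prod_incl_other.
Qed.

Definition prod_idem i : deg0 P := prod_incl (gone (A i)).

Lemma act_prod_idem i n (x : P n) : act (prod_idem i) x = prod_incl (x i).
Proof.
have actE j : act (prod_idem i) x j =
    gmul (A j) (add0r n) (prod_incl (gone (A i)) j) (x j).
  by [].
apply: eq_prod_incl => [|j ij]; first by rewrite actE prod_incl_same gmul1.
by rewrite actE prod_incl_other // gmul0l.
Qed.

Lemma prod_idemK i : prod_idem i * prod_idem i = prod_idem i.
Proof. by rewrite -act0E act_prod_idem /prod_idem prod_incl_same. Qed.

Section ToLocal.
Context (B : tdga k) (locB : local_pc B) (f : tdga_mor P B).

Lemma local_one_neq0 : (1 : deg0 B) <> 0.
Proof.
have [_ [S [[pS _] _]]] := locB => B1; apply: (proper_one pS).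
by have [[S0 _ _] _] := pS; rewrite gone0E B1.
Qed.

(** Otherwise every [prod_idem i] goes to 0. The image of 1 in a discrete [D c]
    is, by continuity, that of some [y] which agrees with 1 at a sufficiently
    large finite set of indices; for [y] one minus the product of the
    complements of the corresponding idempotents this image is 0. *)
Lemma mor_hits_idem : exists i, mor_deg0 f (prod_idem i) = 1.
Proof.
have [[C [D [pi [fdD limB]]]] uB] := locB.
apply: contrapT => nof; apply: local_one_neq0.
have f0 i : mor_deg0 f (prod_idem i) = 0.
  have [|//|f1] := unique_maximal_idem uB (a := mor_deg0 f (prod_idem i)).
    by rewrite -rmorphM prod_idemK.
  by case: nof; exists i.
apply: (deg0_limit_eq limB) => c.
pose V : set (P 0) := [set x | pi c 0 (f 0 x) = pi c 0 (f 0 (gone P))].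
have V1 : nbhs (gone P) V.
  have cpf : continuous (fun x : P 0 => pi c 0 (f 0 x)).
    exact: (@mor_continuous _ _ _ (comp_mor (pi c) f) 0).
  have [_ _ disc] := fdD c.
  by apply: (cpf (gone P) [set z | z = _]); apply: open_nbhs_nbhs; split.
have [s sV] := prod_nbhs_finite V1.
pose y : deg0 P := 1 - \prod_(i <- s) (1 - prod_idem i).
have fy : mor_deg0 f y = 0.
  rewrite /y rmorphB rmorph1 rmorph_prod big1 ?subrr // => i _.
  by rewrite rmorphB rmorph1 /= f0 subr0.
have /sV : forall i : I, (i : {classic I}) \in s -> (y : P 0) i = gone P i.
  move=> i si; suff : mor_deg0 (prod_proj i) y = 1 by [].
  have ei : mor_deg0 (prod_proj i) (prod_idem i) = 1 by exact: prod_incl_same.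
  rewrite /y rmorphB rmorph1 rmorph_prod (big_rem _ si) /= rmorphB rmorph1 /= ei.
  by rewrite subrr mul0r subr0.
rewrite /V /= -[f 0 y]/(mor_deg0 f y) fy mor0 mor_one -[gone B]/(1 : deg0 B).
by rewrite rmorph0 => /esym.
Qed.

(** If [prod_idem i] goes to 1, then [x] and [prod_idem i * x] have the same
    image, and the latter only depends on the [i]-th coordinate of [x]. *)
Lemma mor_factor : exists c : {i : I & tdga_mor (A i) B},
  forall n (x : P n), f n x = projT2 c n (x (projT1 c)).
Proof.
have [i fi] := mor_hits_idem.
have fE n (x : P n) : f n x = f n (prod_incl (x i)).
  by rewrite -act_prod_idem mor_act fi act1.
unshelve eexists (existT _ i
  (@TdgaMor k (A i) B (fun n a => f n (prod_incl a)) _ _ _ _ _)).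
- move=> n c a b; rewrite -mor_linear; congr (f n _); apply/esym/eq_prod_incl.
    by rewrite -[LHS]/(c *: prod_incl a i + prod_incl b i) !prod_incl_same.
  move=> j ij; rewrite -[LHS]/(c *: prod_incl a j + prod_incl b j).
  by rewrite !prod_incl_other // scaler0 addr0.
- move=> m n p e a b; rewrite -mor_mul; congr (f p _); apply/esym/eq_prod_incl.
    by rewrite -[LHS]/(gmul (A i) e (prod_incl a i) (prod_incl b i)) !prod_incl_same.
  move=> j ij; rewrite -[LHS]/(gmul (A j) e (prod_incl a j) (prod_incl b j)).
  by rewrite !prod_incl_other // gmul0l.
- exact: fi.
- move=> m n e a; rewrite -mor_diff; congr (f n _); apply/esym/eq_prod_incl.
    by rewrite -[LHS]/(gdiff (A i) e (prod_incl a i)) prod_incl_same.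
  move=> j ij; rewrite -[LHS]/(gdiff (A j) e (prod_incl a j)).
  by rewrite prod_incl_other // gdiff0.
- move=> n a; apply: continuous_comp; first exact: prod_incl_continuous.
  exact: mor_continuous.
by move=> n x; exact: fE.
Qed.

(** Two different indices are told apart by the unit of one of the factors: it
    would be sent both to 1 and to 0. *)
Lemma mor_factor_unique (c c' : {i : I & tdga_mor (A i) B}) :
  (forall n (x : P n), f n x = projT2 c n (x (projT1 c))) ->
  (forall n (x : P n), f n x = projT2 c' n (x (projT1 c'))) -> c = c'.
Proof.
case: c c' => [i g] [i' g'] /= fg fg'.
have ii : i = i'.
  apply: contrapT => ii; apply: local_one_neq0.
  have := fg' 0 (prod_incl (gone (A i))); rewrite fg prod_incl_same prod_incl_other //.
  by rewrite mor_one mor0.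
case: _ / ii in g' fg' *; congr existT; apply: mor_ext => n a.
by rewrite -[a]prod_incl_same -fg fg'.
Qed.

End ToLocal.
End Products.

Section ProductMorphisms.
Context (k : fieldType) (I J : Type) (A : I -> tdga k) (B : J -> tdga k).
Local Notation choices := (forall j, {i : I & tdga_mor (A i) (B j)}).

Lemma mor_of_choice (c : choices) :
  exists! f : tdga_mor (prod_tdga A) (prod_tdga B),
    forall j n (x : prod_tdga A n), f n x j = projT2 (c j) n (x (projT1 (c j))).
Proof.
unshelve eexists.
  apply: (@TdgaMor k (prod_tdga A) (prod_tdga B)
    (fun n x j => projT2 (c j) n (x (projT1 (c j))))).
  - move=> n a x y; apply: functional_extensionality_dep => j; exact: mor_linear.
  - move=> *; apply: functional_extensionality_dep => j; exact: mor_mul.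
  - by apply: functional_extensionality_dep => j; exact: mor_one.
  - move=> *; apply: functional_extensionality_dep => j; exact: mor_diff.
  - move=> n; apply: prod_continuous => j.
    exact: (@mor_continuous _ _ _
      (comp_mor (projT2 (c j)) (prod_proj A (projT1 (c j)))) n).
split=> // g gP; apply: mor_ext => n x.
by apply: functional_extensionality_dep => j; rewrite gP.
Qed.

Lemma choice_of_mor (f : tdga_mor (prod_tdga A) (prod_tdga B)) :
  (forall j, local_pc (B j)) ->
  exists! c : choices,
    forall j n (x : prod_tdga A n), f n x j = projT2 (c j) n (x (projT1 (c j))).
Proof.
move=> locB.
have [c cP] := dep_choice (fun j => mor_factor (locB j) (comp_mor (prod_proj B j) f)).
exists c; split; first exact: cP.
move=> c' c'P; apply: functional_extensionality_dep => j.
by apply: (mor_factor_unique (locB j) (cP j)) => n x; exact: c'P.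
Qed.

End ProductMorphisms.

Theorem theorem2p9 (k : closedFieldType) (hk : [pchar k]%R =i pred0) :
  (forall A : tdga k, pseudo_compact A ->
     exists (I : Type) (B : I -> tdga k),
       (forall i, hinich (B i) \/ acyclic (B i)) /\
       isomorphic A (prod_tdga B))
  /\
  (forall (I J : Type) (A : I -> tdga k) (B : J -> tdga k),
     (forall i, hinich (A i) \/ acyclic (A i)) ->
     (forall j, hinich (B j) \/ acyclic (B j)) ->
     (forall f : tdga_mor (prod_tdga A) (prod_tdga B),
        exists! c : (forall j, {i : I & tdga_mor (A i) (B j)}),
          forall j n (x : prod_tdga A n),
            f n x j = projT2 (c j) n (x (projT1 (c j))))
     /\
     (forall c : (forall j, {i : I & tdga_mor (A i) (B j)}),
        exists! f : tdga_mor (prod_tdga A) (prod_tdga B),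
          forall j n (x : prod_tdga A n),
            f n x j = projT2 (c j) n (x (projT1 (c j))))).
Proof.
split=> [A [C [D [pi [fdD limA]]]]|I J A B _ locB].
  exists {e : deg0 A | primitive e}, (@primitive_factor k A); split.
    exact: (factor_hinich_or_acyclic limA fdD).
  exact: (factors_isomorphic limA fdD).
split=> [f|c]; last exact: mor_of_choice.
by apply: choice_of_mor => j; case: (locB j) => -[].
Qed.
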